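(* A finite simple graph $G$ is a proper color-line graph if and only if $G$ admits a vertex clique partition $\mathcal{C}$ (that is, $V(G)=\bigcup_{Q\in\mathcal{C}}Q$ with the members of $\mathcal{C}$ pairwise disjoint cliques) such that the graph $G\setminus\big(\bigcup_{Q\in\mathcal{C}}E(Q)\big)$, obtained from $G$ by deleting all edges with both endpoints in a common member of $\mathcal{C}$, is a line graph.
   Context: All graphs are finite and simple. An edge coloring $\phi$ of a graph $H$ is proper if any two distinct edges sharing an endvertex get different colors. For an edge-colored graph $(H,\phi)$, the color-line graph $\mathrm{CL}(H)$ has vertex set $E(H)$, two distinct vertices being adjacent iff the corresponding edges of $H$ share an endvertex or have the same color. $G$ is a proper color-line graph if $G\cong\mathrm{CL}(H)$ for some graph $H$ with a proper edge coloring. The line graph $L(H)$ has vertex set $E(H)$, two edges adjacent iff they share an endvertex; a line graph is a graph isomorphic to $L(H)$ for some graph $H$. For a set $Q$ of vertices, $E(Q)$ is the set of edges of $G$ with both endpoints in $Q$. *)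

(* Defs.v *)
From HB Require Import structures.
From mathcomp Require Import all_boot.

Set Implicit Arguments.
Unset Strict Implicit.
Unset Printing Implicit Defensive.

Record sgraph := SGraph {
  vertex :> finType;
  adj : rel vertex;
  adj_sym : symmetric adj;
  adj_irr : irreflexive adj }.

Definition iso (G H : sgraph) : Prop :=
  exists2 f : G -> H, bijective f & forall x y, adj (f x) (f y) = adj x y.

(* Edges are two-element vertex sets. *)
Definition edges (G : sgraph) : {set {set G}} :=
  [set [set p.1; p.2] | p in [set p : G * G | adj p.1 p.2]].

(* E(G) as a finite type, to serve as the vertex type of other graphs. *)
Definition edge (G : sgraph) : finType := {A : {set G} | A \in edges G}.

Definition share_end (G : sgraph) : rel (edge G) :=
  fun a b => [exists v, (v \in val a) && (v \in val b)].

Lemma share_end_sym (G : sgraph) : symmetric (@share_end G).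
Proof. by move=> a b; apply: eq_existsb => v; rewrite andbC. Qed.

Definition line_adj (G : sgraph) : rel (edge G) :=
  fun a b => (a != b) && share_end a b.

Lemma line_adj_sym (G : sgraph) : symmetric (@line_adj G).
Proof. by move=> a b; rewrite /line_adj eq_sym share_end_sym. Qed.

Lemma line_adj_irr (G : sgraph) : irreflexive (@line_adj G).
Proof. by move=> a; rewrite /line_adj eqxx. Qed.

Definition line_graph (G : sgraph) : sgraph :=
  SGraph (@line_adj_sym G) (@line_adj_irr G).

Definition is_line_graph (G : sgraph) : Prop :=
  exists H : sgraph, iso G (line_graph H).

Definition proper_coloring (H : sgraph) (K : eqType) (phi : edge H -> K) : Prop :=
  forall a b : edge H, a != b -> share_end a b -> phi a != phi b.

Definition cl_adj (H : sgraph) (K : eqType) (phi : edge H -> K) : rel (edge H) :=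
  fun a b => (a != b) && (share_end a b || (phi a == phi b)).

Lemma cl_adj_sym (H : sgraph) (K : eqType) (phi : edge H -> K) :
  symmetric (cl_adj phi).
Proof.
by move=> a b; rewrite /cl_adj eq_sym share_end_sym [phi a == _]eq_sym.
Qed.

Lemma cl_adj_irr (H : sgraph) (K : eqType) (phi : edge H -> K) :
  irreflexive (cl_adj phi).
Proof. by move=> a; rewrite /cl_adj eqxx. Qed.

Definition color_line_graph (H : sgraph) (K : eqType) (phi : edge H -> K) : sgraph :=
  SGraph (cl_adj_sym phi) (cl_adj_irr phi).

Definition is_proper_color_line_graph (G : sgraph) : Prop :=
  exists (H : sgraph) (K : eqType) (phi : edge H -> K),
    proper_coloring phi /\ iso G (color_line_graph phi).

Definition clique (G : sgraph) (Q : {set G}) : Prop :=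
  {in Q &, forall x y, x != y -> adj x y}.

Definition vertex_clique_partition (G : sgraph) (C : {set {set G}}) : Prop :=
  [/\ cover C = [set: G], trivIset C & {in C, forall Q, clique Q}].

Definition edges_in (G : sgraph) (Q : {set G}) : {set {set G}} :=
  [set A in edges G | A \subset Q].

Definition del_adj (G : sgraph) (S : {set {set G}}) : rel G :=
  fun x y => adj x y && ([set x; y] \notin S).

Lemma del_adj_sym (G : sgraph) (S : {set {set G}}) : symmetric (del_adj S).
Proof. by move=> x y; rewrite /del_adj adj_sym setUC. Qed.

Lemma del_adj_irr (G : sgraph) (S : {set {set G}}) : irreflexive (del_adj S).
Proof. by move=> x; rewrite /del_adj adj_irr. Qed.

Definition del_edges (G : sgraph) (S : {set {set G}}) : sgraph :=
  SGraph (@del_adj_sym G S) (@del_adj_irr G S).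

(* Main.v *)
Require Import Defs.
From HB Require Import structures.
From mathcomp Require Import all_boot.

(** The members of a vertex clique partition are the color classes: in a
    proper coloring no two edges of one color share an endvertex, so deleting
    from CL(H) the edges inside color classes leaves exactly L(H); conversely,
    if L(H) is what remains of G after deleting the edges inside the cliques,
    then coloring each edge of H by the clique containing it is proper and
    CL(H) is G. *)

(** As the members of [C] cover and are disjoint, a member containing both ends of an edge is the
    block of each. *)
Lemma del_adj_partition (G : sgraph) (C : {set {set G}}) (x y : G) :
  cover C = [set: G] -> trivIset C ->
  del_adj (\bigcup_(Q in C) edges_in Q) x y
    = adj x y && (pblock C x != pblock C y).
Proof.
move=> covC trC; rewrite /del_adj; case adjxy: (adj x y) => //=; congr negb.
have coverP z : z \in cover C by rewrite covC inE.
rewrite eq_pblock //; apply/bigcupP/idP => [[Q QC] | yx].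
  rewrite inE => /andP[_ /subsetP sQ].
  have xQ : x \in Q by apply: sQ; rewrite !inE eqxx.
  have yQ : y \in Q by apply: sQ; rewrite !inE eqxx orbT.
  by rewrite (def_pblock trC QC xQ).
exists (pblock C x); first exact: pblock_mem.
rewrite inE; apply/andP; split.
  by apply/imsetP; exists (x, y); rewrite ?inE.
by apply/subsetP => z /set2P[] -> //; rewrite mem_pblock.
Qed.

Lemma pblock_preim_partition (T : finType) (K : eqType) (f : T -> K) (x y : T) :
  (pblock (preim_partition f [set: T]) x
     == pblock (preim_partition f [set: T]) y) = (f x == f y).
Proof.
have /and3P[/eqP covC trC _] := preim_partitionP f [set: T].
rewrite eq_pblock ?covC ?inE // pblock_equivalence_partition ?inE //.
by split => // /eqP ->.
Qed.

Lemma preim_partition_block_eq (T : finType) (K : eqType) (f : T -> K)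
    (Q : {set T}) (x y : T) :
  Q \in preim_partition f [set: T] -> x \in Q -> y \in Q -> f x = f y.
Proof.
have /and3P[_ trC _] := preim_partitionP f [set: T].
move=> QC xQ yQ; apply/eqP; rewrite -pblock_preim_partition.
by rewrite !(def_pblock trC QC).
Qed.

Theorem theorem5 (G : sgraph) :
  is_proper_color_line_graph G <->
  exists C : {set {set G}},
    vertex_clique_partition C /\
    is_line_graph (del_edges (\bigcup_(Q in C) edges_in Q)).
Proof.
split=> [[H [K [phi [phi_proper [f bij_f f_adj]]]]] |
         [C [[covC trC cliqueC] [H [f bij_f f_adj]]]]].
  have inj_f := bij_inj bij_f.
  exists (preim_partition (phi \o f) [set: G]).
  have /and3P[/eqP covC trC _] := preim_partitionP (phi \o f) [set: G].
  split.
    split=> // Q QC x y xQ yQ xy.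
    rewrite -f_adj /= /cl_adj (inj_eq inj_f) xy /=.
    by rewrite [phi (f x)](preim_partition_block_eq _ _ _ _ _ _ QC xQ yQ) eqxx orbT.
  exists H, f => // x y /=.
  rewrite del_adj_partition // pblock_preim_partition -f_adj /= /line_adj /cl_adj.
  (* Properness keeps every pair that shares an end; a pair adjacent by color alone is deleted. *)
  case: eqVneq => //= fxy; case: (boolP (share_end _ _)) => [sh | _] /=.
    by rewrite phi_proper.
  by rewrite andbN.
have [g fK gK] := bij_f.
(* The blocks themselves serve as colors. Edges sharing an end come from an adjacency that survived
   the deletion, hence from different blocks. *)
exists H, {set G}, (pblock C \o g); split=> [a b ab sh | ].
  have := f_adj (g a) (g b).
  by rewrite !gK /= del_adj_partition // /line_adj ab sh => /esym/andP[].
exists f => // x y /=.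
have := f_adj x y; rewrite /= del_adj_partition // /line_adj /cl_adj /= !fK.
rewrite (inj_eq (can_inj fK)).
case: (eqVneq x y) => [-> | xy] /=; first by rewrite adj_irr.
(* Only a common block is left to treat: equal colors force adjacency in CL(H), and the clique gives
   it in [G]. *)
move=> ->; case: eqVneq => [eq_xy | _]; last by rewrite andbT orbF.
rewrite andbF /=; apply/esym.
have xC z : z \in cover C by rewrite covC inE.
apply: (cliqueC (pblock C x)) => //; first exact: pblock_mem.
  by rewrite mem_pblock.
by rewrite eq_xy mem_pblock.
Qed.
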